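(* Let $E=\langle \mathcal{B}_x^0,\ldots,\mathcal{B}_x^n, AG^0,\ldots,AG^n,\mathcal{C}\rangle$ be any argumentative exchange (AX) for an explanandum $e$ amongst agents $AG$, where $\mathcal{B}_x^t=\langle\mathcal{X}_x^t,\mathcal{A}_x^t,\mathcal{S}_x^t\rangle$. Then $E$ satisfies: 1. (Connectedness) for any $0\le t\le n$, if $|\mathcal{X}_x^t|>1$ then for all $a\in\mathcal{X}_x^t$ there exists $b\in\mathcal{X}_x^t$ such that $(a,b)\in\mathcal{A}_x^t\cup\mathcal{S}_x^t$ or $(b,a)\in\mathcal{A}_x^t\cup\mathcal{S}_x^t$. 2. (Acyclicity) for any $0\le t\le n$, there is no $a\in\mathcal{X}_x^t$ with a path from $a$ to $a$ in $\mathcal{B}_x^t$. 3. (Contributor irrelevance) for any AX $\langle {\mathcal{B}_x^0}',\ldots,{\mathcal{B}_x^n}',{AG^0}',\ldots,{AG^n}',\mathcal{C}'\rangle$ for $e$, if ${\mathcal{B}_x^0}'=\mathcal{B}_x^0$, ${\mathcal{B}_x^n}'=\mathcal{B}_x^n$ and ${AG^0}'=AG^0$, then for all $\alpha\in AG$, $\Sigma_\alpha(\mathcal{Q}_\alpha^n,e)=\Sigma_\alpha({\mathcal{Q}_\alpha^n}',e)$, i.e. $\alpha$'s final stance on $e$ is the same in both AXs.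
   Context: BAFs and QBAFs. A bipolar argumentation framework (BAF) is a triple $\langle\mathcal{X},\mathcal{A},\mathcal{S}\rangle$ with $\mathcal{X}$ a finite set (of arguments) and $\mathcal{A},\mathcal{S}\subseteq\mathcal{X}\times\mathcal{X}$ disjoint (attacks and supports). A QBAF is $\langle\mathcal{X},\mathcal{A},\mathcal{S},\tau\rangle$ where $\langle\mathcal{X},\mathcal{A},\mathcal{S}\rangle$ is a BAF and $\tau:\mathcal{X}\to\mathbb{I}$ gives base scores (called biases). For BAFs, $\sqsubseteq$ means componentwise inclusion; for QBAFs, it means componentwise inclusion of $\mathcal{X},\mathcal{A},\mathcal{S}$ plus agreement of the biases on common arguments; between a BAF and a QBAF, $\sqsubseteq$ ignores $\tau$. $\mathcal{F}'\setminus\mathcal{F}$ is the componentwise set difference (with $\tau'$ restricted to $\mathcal{X}'\setminus\mathcal{X}$ for QBAFs); it need not be a (Q)BAF, and $\sqsubseteq$ between such differences is componentwise inclusion. Paths. A path from $a$ to $b$ is a sequence $(c_0,c_1),\ldots,(c_{m-1},c_m)$, $m>0$ (its length), with $c_0=a$, $c_m=b$ and each $(c_{i-1},c_i)\in\mathcal{A}\cup\mathcal{S}$. A (Q)BAF is a (Q)BAF for $e\in\mathcal{X}$ iff (i) there is no $(e,a)\in\mathcal{A}\cup\mathcal{S}$; (ii) every $a\in\mathcal{X}\setminus\{e\}$ has a path to $e$; (iii) no argument has a path to itself. Agents. An evaluation range is a pre-ordered set $\mathbb{I}=\mathbb{I}^+\cup\mathbb{I}^0\cup\mathbb{I}^-$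 (disjoint union) with $k<j<i$ for all $i\in\mathbb{I}^+,j\in\mathbb{I}^0,k\in\mathbb{I}^-$. A private triple for agent $\alpha$ and $e$ is $(\mathbb{I}_\alpha,\mathcal{Q}_\alpha,\sigma_\alpha)$ with $\mathbb{I}_\alpha$ an evaluation range, $\mathcal{Q}_\alpha=\langle\mathcal{X}_\alpha,\mathcal{A}_\alpha,\mathcal{S}_\alpha,\tau_\alpha\rangle$ a QBAF for $e$ with biases in $\mathbb{I}_\alpha$, and $\sigma_\alpha$ an evaluation method, assigning to any QBAF $\mathcal{Q}$ with biases in $\mathbb{I}_\alpha$ and any argument $a$ in it a value $\sigma_\alpha(\mathcal{Q},a)\in\mathbb{I}_\alpha$. The stance is $\Sigma_\alpha(\mathcal{Q}_\alpha,a)=*$ iff $\sigma_\alpha(\mathcal{Q}_\alpha,a)\in\mathbb{I}_\alpha^*$, for $*\in\{-,0,+\}$. AXs. An argumentative exchange (AX) for $e$ amongst agents $AG$ ($|AG|\ge2$) is $\langle\mathcal{B}_x^0,\ldots,\mathcal{B}_x^n,AG^0,\ldots,AG^n,\mathcal{C}\rangle$, $n>0$, where: each $\mathcal{B}_x^t=\langle\mathcal{X}_x^t,\mathcal{A}_x^t,\mathcal{S}_x^t\rangle$ is a BAF for $e$ (exchange BAF at $t$), $\mathcal{X}_x^0=\{e\}$, $\mathcal{A}_x^0=\mathcal{S}_x^0=\emptyset$, and $\mathcal{B}_x^{t-1}\sqsubseteq\mathcal{B}_x^t$ for $t>0$; each $AG^t$ consists of one private triple $(\mathbb{I}_\alpha^t,\mathcal{Q}_\alpha^t,\sigma_\alpha^t)$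 for $e$ per $\alpha\in AG$, where for $t>0$, $\mathbb{I}_\alpha^{t-1}=\mathbb{I}_\alpha^t$, $\sigma_\alpha^{t-1}=\sigma_\alpha^t$ (written $\sigma_\alpha$), $\mathcal{Q}_\alpha^{t-1}\sqsubseteq\mathcal{Q}_\alpha^t$ and $\mathcal{Q}_\alpha^t\setminus\mathcal{Q}_\alpha^{t-1}\sqsubseteq\mathcal{B}_x^t\setminus\mathcal{B}_x^{t-1}$; and $\mathcal{C}$ (contributor mapping) maps every $(a,b)\in\mathcal{A}_x^n\cup\mathcal{S}_x^n$ to some $(\alpha,t)$ with $\alpha\in AG$, $0<t\le n$. Elements of $\mathcal{X}_\alpha^t\setminus\mathcal{X}_\alpha^{t-1}$ are the arguments learnt by $\alpha$ at $t$; agents have a choice on their biases on learnt arguments. Primed objects in the claim, such as ${\mathcal{Q}_\alpha^n}'$, are the corresponding components of the second AX. Standing assumptions. Agents are truthful: if $\mathcal{C}((a,b))=(\alpha,t)$ and $(a,b)\in\mathcal{A}_x^n$ (resp. $\mathcal{S}_x^n$) then $(a,b)\in\mathcal{A}_\alpha^{t-1}$ (resp. $\mathcal{S}_\alpha^{t-1}$). Agents learn everything exchanged: $\mathcal{B}_x^t\setminus\mathcal{B}_x^{t-1}\sqsubseteq\mathcal{Q}_\alpha^t$ for all $\alpha\in AG$, $t>0$. Agents aware of the same two arguments agree on any attack or support between them.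
   Formalization: Claim 3 additionally assumes that each agent gives every argument it learns in both AXs the same bias in both; without this it is false, since an agent may learn an attacker of e with different biases and end with different stances. *)

(* Defs.v *)
From mathcomp Require Import all_boot all_order finmap.

Set Implicit Arguments.
Unset Strict Implicit.
Unset Printing Implicit Defensive.

Local Open Scope fset_scope.

(* The common shape of BAFs and of the componentwise differences of BAFs,
   which need not be BAFs themselves. *)
Record arg_struct (Arg : choiceType) := ArgStruct {
  args : {fset Arg};
  att : {fset Arg * Arg};
  sup : {fset Arg * Arg}
}.

Section ArgStructs.
Variable Arg : choiceType.
Implicit Types F G : arg_struct Arg.

Definition rels F : {fset Arg * Arg} := att F `|` sup F.

Definition is_baf F : bool :=
  [&& att F `<=` args F `*` args F, sup F `<=` args F `*` args F
    & [disjoint (att F) & (sup F)]%fset].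

Definition arg_sub F G : bool :=
  [&& args F `<=` args G, att F `<=` att G & sup F `<=` sup G].

Definition arg_diff F G : arg_struct Arg :=
  ArgStruct (args F `\` args G) (att F `\` att G) (sup F `\` sup G).

Definition has_path F (a b : Arg) : Prop :=
  exists c : seq Arg,
    [/\ c != [::], path (fun x y => (x, y) \in rels F) a c & last a c = b].

Definition for_explanandum (e : Arg) F : Prop :=
  [/\ e \in args F,
      forall a, (e, a) \notin rels F,
      forall a, a \in args F -> a != e -> has_path F a e
    & forall a, a \in args F -> ~ has_path F a a].

End ArgStructs.

Record baf (Arg : choiceType) := BAF {
  baf_struct :> arg_struct Arg;
  baf_wf : is_baf baf_struct
}.

Inductive sign := Minus | Zero | Plus.

Record eval_range := EvalRange {
  er_disp : Order.disp_t;
  er_car :> preorderType er_disp;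
  er_part : sign -> {pred er_car};
  er_cover : forall v, exists s, v \in er_part s;
  er_disjoint : forall v s s', v \in er_part s -> v \in er_part s' -> s = s';
  er_order : forall i j k,
    i \in er_part Plus -> j \in er_part Zero -> k \in er_part Minus ->
    (k < j)%O /\ (j < i)%O
}.

(* Biases are a finite function on exactly the arguments of the BAF, so that
   Leibniz equality of QBAFs is the intended equality. *)
Record qbaf (Arg : choiceType) (I : eval_range) := QBAF {
  qbaf_baf :> baf Arg;
  bias : {ffun args qbaf_baf -> I}
}.

Definition qbaf_sub (Arg : choiceType) (I : eval_range) (Q Q' : qbaf Arg I) :
    Prop :=
  arg_sub Q Q' /\
  forall a (aQ : a \in args Q) (aQ' : a \in args Q'),
    bias Q [` aQ] = bias Q' [` aQ'].

Definition eval_method (Arg : choiceType) (I : eval_range) :=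
  forall Q : qbaf Arg I, args Q -> I.

Definition sign_of (I : eval_range) (v : I) : sign :=
  if v \in er_part Minus then Minus
  else if v \in er_part Zero then Zero else Plus.

Lemma sign_ofP (I : eval_range) (v : I) (s : sign) :
  sign_of v = s <-> v \in er_part s.
Proof.
have vs : v \in er_part (sign_of v).
  rewrite /sign_of; case: ifP => [//|vM]; case: ifP => [//|vZ].
  by case: (er_cover v) => -[]; rewrite ?vM ?vZ.
by split=> [<- //|]; apply: er_disjoint.
Qed.

Record private_triple (Arg : choiceType) := PrivateTriple {
  pt_range : eval_range;
  pt_qbaf : qbaf Arg pt_range;
  pt_eval : eval_method Arg pt_range
}.

Definition stance (Arg : choiceType) (T : private_triple Arg)
    (a : args (pt_qbaf T)) : sign :=
  sign_of (pt_eval a).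

(* Evolution of a private triple while the exchange BAF goes from B to B'.
   The shared indices I and m express that range and method do not change. *)
Variant private_step (Arg : choiceType) (B B' : baf Arg) :
    private_triple Arg -> private_triple Arg -> Prop :=
  PrivateStep I (Q Q' : qbaf Arg I) (m : eval_method Arg I) of
      qbaf_sub Q Q' & arg_sub (arg_diff Q' Q) (arg_diff B' B) :
    private_step B B' (PrivateTriple Q m) (PrivateTriple Q' m).

(* Time is indexed by nat; for an exchange of length n only the values at
   0, ..., n are constrained or used, and likewise contrib matters only on the
   relations of the last exchange BAF. *)
Record exchange (Arg : choiceType) (AG : Type) := Exchange {
  xbaf : nat -> baf Arg;
  priv : nat -> AG -> private_triple Arg;
  contrib : Arg * Arg -> AG * nat
}.

Section Exchanges.
Variables (Arg : choiceType) (AG : Type) (e : Arg) (n : nat).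
Implicit Types E : exchange Arg AG.

Record is_AX E : Prop := IsAX {
  ax_agents : exists alpha beta : AG, alpha <> beta;
  ax_length : 0 < n;
  ax_xbaf_for : forall t, t <= n -> for_explanandum e (xbaf E t);
  ax_xbaf0 : baf_struct (xbaf E 0) = ArgStruct [fset e] fset0 fset0;
  ax_xbaf_sub : forall t, 0 < t <= n -> arg_sub (xbaf E t.-1) (xbaf E t);
  ax_priv_for : forall t alpha, t <= n ->
    for_explanandum e (pt_qbaf (priv E t alpha));
  ax_priv_step : forall t alpha, 0 < t <= n ->
    private_step (xbaf E t.-1) (xbaf E t) (priv E t.-1 alpha) (priv E t alpha);
  ax_contrib : forall p, p \in rels (xbaf E n) -> 0 < (contrib E p).2 <= n
}.

Definition truthful E : Prop :=
  forall p alpha t, p \in rels (xbaf E n) -> contrib E p = (alpha, t) ->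
    (p \in att (xbaf E n) -> p \in att (pt_qbaf (priv E t.-1 alpha))) /\
    (p \in sup (xbaf E n) -> p \in sup (pt_qbaf (priv E t.-1 alpha))).

Definition learns_everything E : Prop :=
  forall t alpha, 0 < t <= n ->
    arg_sub (arg_diff (xbaf E t) (xbaf E t.-1)) (pt_qbaf (priv E t alpha)).

Definition agree_on_rels E : Prop :=
  forall t alpha beta a b, t <= n ->
    let Qa := pt_qbaf (priv E t alpha) in
    let Qb := pt_qbaf (priv E t beta) in
    a \in args Qa -> b \in args Qa -> a \in args Qb -> b \in args Qb ->
    ((a, b) \in att Qa) = ((a, b) \in att Qb) /\
    ((a, b) \in sup Qa) = ((a, b) \in sup Qb).

Definition standing_assumptions E : Prop :=
  [/\ truthful E, learns_everything E & agree_on_rels E].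

Definition learnt E (alpha : AG) (t : nat) : {fset Arg} :=
  args (pt_qbaf (priv E t alpha)) `\` args (pt_qbaf (priv E t.-1 alpha)).

(* The bias is paired with its evaluation range, so that biases in triples
   with a priori different ranges can be compared. *)
Definition ranged_bias (T : private_triple Arg) (a : args (pt_qbaf T)) :
    {I : eval_range & I} :=
  existT (fun I : eval_range => I) (pt_range T) (bias (pt_qbaf T) a).

(* The bias that an agent chooses for an argument when learning it is the same
   in both exchanges, even if it is learnt at different times. *)
Definition same_bias_choices E E' : Prop :=
  forall alpha t t' a (aQ : a \in args (pt_qbaf (priv E t alpha)))
      (aQ' : a \in args (pt_qbaf (priv E' t' alpha))),
    0 < t <= n -> 0 < t' <= n ->
    a \in learnt E alpha t -> a \in learnt E' alpha t' ->
    ranged_bias [` aQ] = ranged_bias [` aQ'].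

End Exchanges.

(* Main.v *)
Require Import Defs.
From mathcomp Require Import all_boot all_order finmap.
From Stdlib Require Import Eqdep.

(** An agent's final QBAF is determined by its initial QBAF, the last exchange
    BAF and the bias choices: each component of the agent's QBAF at time t is
    the union of that component at time 0 and of the exchange BAF at time t,
    and biases never change once chosen. Hence the final private triples of an
    agent in the two exchanges are equal. *)

Set Implicit Arguments.
Unset Strict Implicit.
Unset Printing Implicit Defensive.

Local Open Scope fset_scope.

(** By induction on time: whatever enters [q] at a step entered [b] at that step, whatever enters
    [b] is learnt by [q], and monotonicity keeps all the rest. *)
Lemma fset_chain_union (K : choiceType) (q b : nat -> {fset K}) (n : nat) :
    b 0 `<=` q 0 ->
    (forall t, 0 < t <= n -> b t.-1 `<=` b t) ->
    (forall t, 0 < t <= n -> q t.-1 `<=` q t) ->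
    (forall t, 0 < t <= n -> q t `\` q t.-1 `<=` b t `\` b t.-1) ->
    (forall t, 0 < t <= n -> b t `\` b t.-1 `<=` q t) ->
  q n = q 0 `|` b n.
Proof.
move=> b0 bS qS new learn.
suff: forall t, t <= n -> q t = q 0 `|` b t by apply.
elim=> [_|t IHt tn]; first by apply/esym/fsetUidPl.
have qt := IHt (ltnW tn).
have /fsubsetP bSt := bS t.+1 tn; have /fsubsetP qSt := qS t.+1 tn.
have /fsubsetP newt := new t.+1 tn; have /fsubsetP learnt := learn t.+1 tn.
rewrite /= in bSt qSt newt learnt.
apply/fsetP=> x; rewrite inE; apply/idP/orP => [xq|[x0|xb]].
- have [xqt|xqt] := boolP (x \in q t).
    by move: xqt; rewrite qt inE => /orP[->|/bSt]; [left|right].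
  by have := newt x; rewrite !inE xq xqt => /(_ isT)/andP[_ ->]; right.
- by apply: qSt; rewrite qt inE x0.
- have [xbt|xbt] := boolP (x \in b t).
    by apply: qSt; rewrite qt inE xbt orbT.
  by apply: learnt; rewrite !inE xbt xb.
Qed.

Section ArgStructs.
Variable Arg : choiceType.
Implicit Types (B : baf Arg) (T : private_triple Arg).

Lemma rels_args B a b :
  (a, b) \in rels B -> a \in args B /\ b \in args B.
Proof.
case/and3P: (baf_wf B) => /fsubsetP attB /fsubsetP supB _.
by rewrite inE => /orP[/attB|/supB]; rewrite in_fsetM => /andP[].
Qed.

(** If [a] is not [e], the first edge of its path to [e] serves. If [a] is [e], some other argument
    exists by cardinality, and the last edge of its path enters [e]. *)
Lemma for_explanandum_connected e B a :
    for_explanandum e B -> 1 < #|` args B| -> a \in args B ->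
  exists2 b, b \in args B & ((a, b) \in rels B) \/ ((b, a) \in rels B).
Proof.
case=> eB _ reach _ cardB aB; have [->|ae] := eqVneq a e; last first.
  case: (reach a aB ae) => -[|b c] [//= _ /andP[ab _] _].
  by exists b; [case: (rels_args ab)|left].
have [c cB ce] : exists2 c, c \in args B & c != e.
  have : 0 < #|` args B `\ e| by move: cardB; rewrite (cardfsD1 e) eB.
  by rewrite cardfs_gt0 => /fset0Pn[c]; rewrite !inE => /andP[]; exists c.
case: (reach c cB ce) => s []; case/lastP: s => [//|s d] _.
rewrite rcons_path last_rcons => /andP[_ de] ed; rewrite ed in de.
by exists (last c s); [case: (rels_args de)|right].
Qed.

Lemma qbaf_ext (I : eval_range) (Q Q' : qbaf Arg I) :
    baf_struct Q = baf_struct Q' ->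
    (forall a (aQ : a \in args Q) (aQ' : a \in args Q'),
      bias Q [` aQ] = bias Q' [` aQ']) ->
  Q = Q'.
Proof.
case: Q Q' => [[F wF] f] [[F' wF'] f'] /= eqF; case: F' / eqF in wF' f' *.
(* The domain of the bias function depends on the whole BAF, so the well-formedness proofs must be
   identified before [f] and [f'] can be compared. *)
rewrite (bool_irrelevance wF' wF) in f' * => ff'; congr QBAF.
by apply/ffunP => -[a aF]; apply: ff'.
Qed.

(** Taking [Q] over the range of [T] itself makes range and method persist without any transport
    between ranges. Unlike [private_step], this relation is transitive and mentions no exchange
    BAF. *)
Definition extends T T' : Prop :=
  exists2 Q : qbaf Arg (pt_range T),
    T' = PrivateTriple Q (@pt_eval _ T) & qbaf_sub (pt_qbaf T) Q.

Lemma extends_refl T : extends T T.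
Proof.
case: T => I Q m; exists Q => //; split=> [|a aQ aQ'].
  by rewrite /arg_sub !fsubset_refl.
by rewrite (bool_irrelevance aQ aQ').
Qed.

Lemma extends_trans T1 T2 T3 : extends T1 T2 -> extends T2 T3 -> extends T1 T3.
Proof.
case=> Q2 -> [/and3P[a12 t12 s12] b12] [/= Q3 ->] /= [/and3P[a23 t23 s23] b23].
exists Q3 => //; split=> [|a aQ1 aQ3].
  by apply/and3P; split; apply: fsubset_trans; eassumption.
have aQ2 := fsubsetP a12 a aQ1.
by rewrite (b12 a aQ1 aQ2) (b23 a aQ2 aQ3).
Qed.

Lemma private_step_extends B B' T T' : private_step B B' T T' -> extends T T'.
Proof. by case=> I Q Q' m QQ' _; exists Q'. Qed.

Lemma extends_args T T' :
  extends T T' -> arg_sub (pt_qbaf T) (pt_qbaf T').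
Proof. by case=> Q -> []. Qed.

Lemma extends_bias T T' a (aT : a \in args (pt_qbaf T))
    (aT' : a \in args (pt_qbaf T')) :
  extends T T' -> ranged_bias [` aT] = ranged_bias [` aT'].
Proof.
case=> Q eT [_ bQ]; subst T'.
by rewrite /ranged_bias /= (bQ a aT aT').
Qed.

(* Only a common extension T0 guarantees that T and T' have the same
   evaluation range and method. *)
Lemma extends_ext T0 T T' :
    extends T0 T -> extends T0 T' ->
    baf_struct (pt_qbaf T) = baf_struct (pt_qbaf T') ->
    (forall a (aT : a \in args (pt_qbaf T)) (aT' : a \in args (pt_qbaf T')),
      ranged_bias [` aT] = ranged_bias [` aT']) ->
  T = T'.
Proof.
case=> Q -> _ [Q' -> _] /= eqF eqb; congr PrivateTriple.
(* Both pairs now have the same range; equality of ranges is not decidable, so equality of the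
   second components comes from the axiom behind [inj_pair2]. *)
by apply: qbaf_ext => // a aQ aQ'; apply: inj_pair2 (eqb a aQ aQ').
Qed.

End ArgStructs.

Section Exchanges.
Variables (Arg : choiceType) (AG : Type) (e : Arg) (n : nat).
Implicit Types E : exchange Arg AG.

Lemma priv_extends E alpha s t :
  is_AX e n E -> s <= t <= n -> extends (priv E s alpha) (priv E t alpha).
Proof.
move=> hE; elim: t => [|t IHt] /andP[].
  by rewrite leqn0 => /eqP-> _; apply: extends_refl.
rewrite leq_eqVlt => /predU1P[-> _|st tn]; first exact: extends_refl.
apply: extends_trans (IHt _) _; first by rewrite -ltnS st ltnW.
exact: private_step_extends (ax_priv_step hE alpha (t := t.+1) tn).
Qed.

Lemma final_struct E alpha :
    is_AX e n E -> learns_everything n E ->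
  let Q t := baf_struct (pt_qbaf (priv E t alpha)) in
  Q n = ArgStruct (args (Q 0) `|` args (xbaf E n))
                  (att (Q 0) `|` att (xbaf E n))
                  (sup (Q 0) `|` sup (xbaf E n)).
Proof.
move=> hE lE Q.
have x0 := ax_xbaf0 hE.
have e0 : e \in args (Q 0) by case: (ax_priv_for hE alpha (leq0n n)).
have bS t (tn : 0 < t <= n) := and3P (ax_xbaf_sub hE tn).
have qS t : 0 < t <= n -> arg_sub (Q t.-1) (Q t).
  move=> tn.
  exact/extends_args/private_step_extends/(ax_priv_step hE alpha tn).
have new t : 0 < t <= n ->
    arg_sub (arg_diff (Q t) (Q t.-1)) (arg_diff (xbaf E t) (xbaf E t.-1)).
  by move=> tn; rewrite /Q; case: (ax_priv_step hE alpha tn).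
(* Eta-expansion of the record, so that [congr] yields one chain of sets per component. At time 0
   the inclusion holds because [e] is in every private QBAF and no relation has been exchanged. *)
rewrite [LHS](_ : _ = ArgStruct (args (Q n)) (att (Q n)) (sup (Q n)));
  last by case: (Q n).
congr ArgStruct.
- apply: (fset_chain_union (q := fun t => args (Q t))
      (b := fun t => args (xbaf E t)));
    rewrite /= ?x0 ?fsub1set // => t tn.
  + by case: (bS t tn).
  + by case/and3P: (qS t tn).
  + by case/and3P: (new t tn).
  + by case/and3P: (lE t alpha tn).
- apply: (fset_chain_union (q := fun t => att (Q t))
      (b := fun t => att (xbaf E t)));
    rewrite /= ?x0 ?fsub0set // => t tn.
  + by case: (bS t tn).
  + by case/and3P: (qS t tn).
  + by case/and3P: (new t tn).
  + by case/and3P: (lE t alpha tn).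
- apply: (fset_chain_union (q := fun t => sup (Q t))
      (b := fun t => sup (xbaf E t)));
    rewrite /= ?x0 ?fsub0set // => t tn.
  + by case: (bS t tn).
  + by case/and3P: (qS t tn).
  + by case/and3P: (new t tn).
  + by case/and3P: (lE t alpha tn).
Qed.

(** Going back from [n], stop at the first time [m] when [a] is absent: it was learnt at [m.+1]. *)
Lemma learnt_at E alpha a :
    a \in args (pt_qbaf (priv E n alpha)) ->
    a \notin args (pt_qbaf (priv E 0 alpha)) ->
  exists2 t, 0 < t <= n & a \in learnt E alpha t.
Proof.
move=> an a0; elim: n an => [|m IHm] am; first by rewrite am in a0.
have [/IHm[t /andP[t0 tm]]|am'] :=
    boolP (a \in args (pt_qbaf (priv E m alpha))).
  by exists t; rewrite // t0 leqW.
by exists m.+1; rewrite ?leqnn // inE am am'.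
Qed.

Lemma final_priv_eq E E' alpha :
    is_AX e n E -> is_AX e n E' ->
    learns_everything n E -> learns_everything n E' ->
    same_bias_choices n E E' ->
    xbaf E' n = xbaf E n -> priv E' 0 alpha = priv E 0 alpha ->
  priv E n alpha = priv E' n alpha.
Proof.
move=> hE hE' lE lE' same xn p0.
have ext s : s <= n -> extends (priv E s alpha) (priv E n alpha).
  by move=> sn; apply: priv_extends; rewrite ?sn /=.
have ext' s : s <= n -> extends (priv E' s alpha) (priv E' n alpha).
  by move=> sn; apply: priv_extends; rewrite ?sn /=.
(* The shared initial triple is the common extension base that fixes range and method in both
   exchanges. *)
have ext0 : extends (priv E 0 alpha) (priv E' n alpha).
  by rewrite -p0; apply: ext'.
apply: (extends_ext (ext 0 _) ext0) => // [|a an an'].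
  by rewrite (final_struct alpha hE lE) (final_struct alpha hE' lE') p0 xn.
have [a0|a0] := boolP (a \in args (pt_qbaf (priv E 0 alpha))).
  by rewrite -(extends_bias a0 an (ext 0 _)) // -(extends_bias a0 an' ext0).
(* An argument absent initially is learnt in each exchange, possibly at different times [t] and
   [t']; the choices made then agree and persist up to [n]. *)
have [t tn at_] := learnt_at an a0.
have [|t' tn' at'] := learnt_at an'; first by rewrite p0.
have [/fsetDP[aQ _] /fsetDP[aQ' _]] := (at_, at').
have [/andP[_ tle] /andP[_ tle']] := (tn, tn').
rewrite -(extends_bias aQ an (ext t tle)).
by rewrite -(extends_bias aQ' an' (ext' t' tle')); apply: same at_ at'.
Qed.

End Exchanges.

Theorem proposition1 (Arg : choiceType) (AG : Type) (e : Arg) (n : nat)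
    (E : exchange Arg AG)
    (hE : is_AX e n E) (hsE : standing_assumptions n E) :
  [/\ (* Connectedness *)
      forall t, t <= n -> 1 < #|` args (xbaf E t)| ->
        forall a, a \in args (xbaf E t) ->
        exists2 b, b \in args (xbaf E t)
          & ((a, b) \in rels (xbaf E t)) \/ ((b, a) \in rels (xbaf E t)),
      (* Acyclicity *)
      forall t, t <= n ->
        ~ exists2 a, a \in args (xbaf E t) & has_path (xbaf E t) a a
    & (* Contributor irrelevance *)
      forall E' : exchange Arg AG,
        is_AX e n E' -> standing_assumptions n E' ->
        same_bias_choices n E E' ->
        xbaf E' 0 = xbaf E 0 -> xbaf E' n = xbaf E n ->
        (forall alpha, priv E' 0 alpha = priv E 0 alpha) ->
        forall alpha (he : e \in args (pt_qbaf (priv E n alpha)))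
          (he' : e \in args (pt_qbaf (priv E' n alpha))),
        stance [` he]%fset = stance [` he']%fset].
Proof.
split=> [t tn|t tn [a aB]|E' hE' [_ lE' _] same _ xn p0 alpha].
- move=> cardB a; exact: for_explanandum_connected (ax_xbaf_for hE tn) cardB.
- by case: (ax_xbaf_for hE tn) => _ _ _ /(_ a aB).
- case: hsE => _ lE _.
  (* The types of [he] and [he'] depend on the triples, so the rewriting precedes their
     introduction; afterwards only two proofs of one membership differ. *)
  rewrite (final_priv_eq hE hE' lE lE' same xn (p0 alpha)) => he he'.
  by rewrite (bool_irrelevance he he').
Qed.
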